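(* Let $k$ be a field of characteristic $3$. For any integer $n>1$, the group algebras $kC_3$ and $kC_{3^n}$ are not separably equivalent.
   Context: $C_r$ denotes the cyclic group of order $r$. Two finite dimensional $k$-algebras $A$ and $B$ are separably equivalent if there are bimodules ${}_AM_B$ and ${}_BN_A$ (with $k$ acting centrally), each finitely generated and projective as a left module and as a right module, together with bimodules ${}_AX_A$, ${}_BY_B$ and bimodule isomorphisms $M\otimes_B N\cong A\oplus X$ and $N\otimes_A M\cong B\oplus Y$. *)

(* Defs.v *)
From HB Require Import structures.
From mathcomp Require Import all_boot all_order all_fingroup all_algebra.
From mathcomp Require Import ring_quotient cyclic falgebra boolp freeg.

Set Implicit Arguments.
Unset Strict Implicit.
Unset Printing Implicit Defensive.

Import GRing.Theory.
Local Open Scope ring_scope.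
Local Open Scope quotient_scope.

(* The group algebra k[gT]: functions gT -> k, where f stands for the formal *)
(* sum of the (f x) x, multiplied by convolution.                            *)
Definition group_algebra (k : fieldType) (gT : finGroupType) : Type :=
  {ffun gT -> k}.

Section GroupAlgebra.
Variables (k : fieldType) (gT : finGroupType).
Local Notation kG := (group_algebra k gT).

HB.instance Definition _ := Vector.copy kG {ffun gT -> k^o}.

Definition galg_elt (x : gT) : kG := [ffun y => (y == x)%:R].
Definition galg_mul (f g : kG) : kG :=
  [ffun x => \sum_(y : gT) f y * g (y^-1 * x)%g].

Fact galg_mulA : associative galg_mul.
Proof.
move=> f g h; apply/ffunP => x; rewrite !ffunE.
under [RHS]eq_bigr => y _ do rewrite ffunE mulr_suml.
rewrite [RHS]exchange_big /=; apply: eq_bigr => z _.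
rewrite ffunE mulr_sumr (reindex_inj (mulgI z^-1%g)) /=.
by apply: eq_bigr => y _; rewrite mulrA invMg invgK -mulgA mulKVg.
Qed.

Fact galg_mul1l : left_id (galg_elt 1%g) galg_mul.
Proof.
move=> f; apply/ffunP => x; rewrite !ffunE (bigD1 1%g) //= ffunE eqxx mul1r.
rewrite invg1 mul1g big1 ?addr0 // => y /negPf ny1.
by rewrite ffunE ny1 mul0r.
Qed.

Fact galg_mul1r : right_id (galg_elt 1%g) galg_mul.
Proof.
move=> f; apply/ffunP => x; rewrite !ffunE (bigD1 x) //= ffunE mulVg eqxx mulr1.
rewrite big1 ?addr0 // => y nyx; rewrite ffunE -eq_mulVg1 (negPf nyx).
by rewrite mulr0.
Qed.

Fact galg_mulDl : left_distributive galg_mul +%R.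
Proof.
move=> f g h; apply/ffunP => x; rewrite !ffunE -big_split /=.
by apply: eq_bigr => y _; rewrite ffunE mulrDl.
Qed.

Fact galg_mulDr : right_distributive galg_mul +%R.
Proof.
move=> f g h; apply/ffunP => x; rewrite !ffunE -big_split /=.
by apply: eq_bigr => y _; rewrite ffunE mulrDr.
Qed.

Fact galg_1neq0 : galg_elt 1%g != 0 :> kG.
Proof.
apply/eqP => /ffunP/(_ 1%g)/eqP; rewrite !ffunE eqxx.
by rewrite oner_eq0.
Qed.

HB.instance Definition _ := GRing.Zmodule_isNzRing.Build kG
  galg_mulA galg_mul1l galg_mul1r galg_mulDl galg_mulDr galg_1neq0.

Lemma galg_scaleE (c : k) (f : kG) x : (c *: f) x = c * f x.
Proof. by rewrite ffunE. Qed.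

Lemma galg_mulE (f g : kG) x : (f * g) x = \sum_(y : gT) f y * g (y^-1 * x)%g.
Proof. by rewrite ffunE. Qed.

Lemma galg_eltM (x y : gT) :
  galg_elt x * galg_elt y = galg_elt (x * y)%g :> kG.
Proof.
apply/ffunP => z; rewrite galg_mulE (bigD1 x) //= !ffunE eqxx mul1r.
rewrite big1 ?addr0 => [|w /negPf nwx]; last by rewrite ffunE nwx mul0r.
by rewrite -(inj_eq (mulgI x)) mulKVg.
Qed.

Fact galg_scaleAl (c : k) (f g : kG) : c *: (f * g) = (c *: f) * g.
Proof.
apply/ffunP => x; rewrite galg_scaleE !galg_mulE mulr_sumr.
by apply: eq_bigr => y _; rewrite galg_scaleE mulrA.
Qed.

Fact galg_scaleAr (c : k) (f g : kG) : c *: (f * g) = f * (c *: g).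
Proof.
apply/ffunP => x; rewrite galg_scaleE !galg_mulE mulr_sumr.
by apply: eq_bigr => y _; rewrite galg_scaleE mulrCA.
Qed.

HB.instance Definition _ := GRing.Lmodule_isLalgebra.Build k kG galg_scaleAl.
HB.instance Definition _ := GRing.Lalgebra_isAlgebra.Build k kG galg_scaleAr.
HB.instance Definition _ := Algebra_isFalgebra.Build k kG.

End GroupAlgebra.

Definition fin_generated (R : nzRingType) (P : lmodType R) : Prop :=
  exists (n : nat) (e : 'I_n -> P),
    forall x : P, exists c : 'I_n -> R, x = \sum_(i < n) c i *: e i.

Definition projective (R : nzRingType) (P : lmodType R) : Prop :=
  forall (U V : lmodType R) (g : {linear U -> V}) (f : {linear P -> V}),
    (forall v : V, exists u : U, g u = v) ->
  exists h : {linear P -> U}, forall x : P, g (h x) = f x.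

(* actlr_central: the two actions of k, through A and through B, agree. *)
HB.mixin Record Zmodule_isBimodule (k : fieldType) (A B : algType k) M
    of GRing.Zmodule M := {
  actl : A -> M -> M;
  actr : M -> B -> M;
  actl1 : forall m, actl 1 m = m;
  actlA : forall a a' m, actl a (actl a' m) = actl (a * a') m;
  actlDl : forall a a' m, actl (a + a') m = actl a m + actl a' m;
  actlDr : forall a m m', actl a (m + m') = actl a m + actl a m';
  actr1 : forall m, actr m 1 = m;
  actrA : forall m b b', actr (actr m b) b' = actr m (b * b');
  actrDl : forall m m' b, actr (m + m') b = actr m b + actr m' b;
  actrDr : forall m b b', actr m (b + b') = actr m b + actr m b';
  actlrA : forall a m b, actl a (actr m b) = actr (actl a m) b;
  actlr_central : forall (c : k) m, actl c%:A m = actr m c%:A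
}.

#[short(type="bimodType")]
HB.structure Definition Bimodule (k : fieldType) (A B : algType k) :=
  { M of GRing.Zmodule M & Zmodule_isBimodule k A B M }.

Definition left_module (k : fieldType) (A B : algType k) (M : bimodType A B)
  : Type := M.

(* A bimodule seen as a right B-module, i.e., as a left module over the      *)
(* converse ring B^c.                                                        *)
Definition right_module (k : fieldType) (A B : algType k) (M : bimodType A B)
  : Type := M.

Section OneSided.
Variables (k : fieldType) (A B : algType k) (M : bimodType A B).

HB.instance Definition _ := GRing.Zmodule.copy (left_module M) M.
HB.instance Definition _ := GRing.Zmodule_isLmodule.Build A (left_module M)
  (@actlA k A B M) (@actl1 k A B M) (@actlDr k A B M)
  (fun m a a' => @actlDl k A B M a a' m).

Let rscale (b : B^c) (m : M) : M := actr m b.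

Fact rscaleA b b' m : rscale b (rscale b' m) = rscale (b * b') m.
Proof. exact: actrA. Qed.
Fact rscale1 : left_id 1 rscale.
Proof. exact: actr1. Qed.
Fact rscaleDr : right_distributive rscale +%R.
Proof. by move=> b m m'; apply: actrDl. Qed.
Fact rscaleDl m : {morph rscale^~ m : b b' / b + b'}.
Proof. by move=> b b'; apply: actrDr. Qed.

HB.instance Definition _ := GRing.Zmodule.copy (right_module M) M.
HB.instance Definition _ := GRing.Zmodule_isLmodule.Build B^c (right_module M)
  rscaleA rscale1 rscaleDr rscaleDl.

End OneSided.

Definition two_sided_fgp (k : fieldType) (A B : algType k) (M : bimodType A B)
  : Prop :=
  [/\ fin_generated (left_module M), projective (left_module M),
      fin_generated (right_module M) & projective (right_module M)].

Definition bimod_iso (k : fieldType) (A B : algType k) (M N : bimodType A B)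
  : Prop :=
  exists f : M -> N,
    [/\ bijective f,
        forall x y, f (x + y) = f x + f y,
        forall a x, f (actl a x) = actl a (f x)
      & forall x b, f (actr x b) = actr (f x) b].

Definition regular_bimodule (k : fieldType) (A : algType k) : Type := A.

Section Regular.
Variables (k : fieldType) (A : algType k).

HB.instance Definition _ := GRing.Zmodule.copy (regular_bimodule A) A.

Fact regular_central (c : k) (x : A) : c%:A * x = x * c%:A.
Proof. by rewrite mulr_algl mulr_algr. Qed.

HB.instance Definition _ := @Zmodule_isBimodule.Build k A A
  (regular_bimodule A) *%R *%R
  (@mul1r A) (fun a b c => mulrA a b c) (fun a b c => mulrDl a b c)
  (fun a b c => mulrDr a b c)
  (@mulr1 A) (fun a b c => esym (mulrA a b c)) (fun a b c => mulrDl a b c)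
  (fun a b c => mulrDr a b c)
  (fun a b c => mulrA a b c) regular_central.
End Regular.

(* The direct sum of two bimodules, carried by their product. *)
Section DirectSum.
Variables (k : fieldType) (A B : algType k) (M N : bimodType A B).
Implicit Types (x y : M * N) (a : A) (b : B).

Let pactl a x : M * N := (actl a x.1, actl a x.2).
Let pactr x b : M * N := (actr x.1 b, actr x.2 b).

Fact pactl1 x : pactl 1 x = x.
Proof. by case: x => m n; rewrite /pactl /= !actl1. Qed.
Fact pactlA a a' x : pactl a (pactl a' x) = pactl (a * a') x.
Proof. by rewrite /pactl /= !actlA. Qed.
Fact pactlDl a a' x : pactl (a + a') x = pactl a x + pactl a' x.
Proof. by rewrite /pactl !actlDl. Qed.
Fact pactlDr a x y : pactl a (x + y) = pactl a x + pactl a y.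
Proof. by rewrite /pactl /= !actlDr. Qed.
Fact pactr1 x : pactr x 1 = x.
Proof. by case: x => m n; rewrite /pactr /= !actr1. Qed.
Fact pactrA x b b' : pactr (pactr x b) b' = pactr x (b * b').
Proof. by rewrite /pactr /= !actrA. Qed.
Fact pactrDl x y b : pactr (x + y) b = pactr x b + pactr y b.
Proof. by rewrite /pactr /= !actrDl. Qed.
Fact pactrDr x b b' : pactr x (b + b') = pactr x b + pactr x b'.
Proof. by rewrite /pactr !actrDr. Qed.
Fact pactlrA a x b : pactl a (pactr x b) = pactr (pactl a x) b.
Proof. by rewrite /pactl /pactr /= !actlrA. Qed.
Fact pactlr_central (c : k) x : pactl c%:A x = pactr x c%:A.
Proof. by rewrite /pactl /pactr !actlr_central. Qed.

HB.instance Definition _ := @Zmodule_isBimodule.Build k A B (M * N)%type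
  pactl pactr pactl1 pactlA pactlDl pactlDr pactr1 pactrA pactrDl pactrDr
  pactlrA pactlr_central.
End DirectSum.

(* M (x)_B N is the quotient of the free abelian group on M * N by the       *)
(* subgroup generated by the biadditivity and B-balancing relations.         *)
Section Tensor.
Variables (k : fieldType) (A B C : algType k).
Variables (M : bimodType A B) (N : bimodType B C).

Local Notation gen m n := (<< (m, n) >> : {freeg (M * N)%type}).

Inductive tensor_relation : {freeg (M * N)%type} -> Prop :=
| tensor_rel0 : tensor_relation 0
| tensor_relB x y :
    tensor_relation x -> tensor_relation y -> tensor_relation (x - y)
| tensor_relDl m m' n :
    tensor_relation (gen (m + m') n - (gen m n + gen m' n))
| tensor_relDr m n n' :
    tensor_relation (gen m (n + n') - (gen m n + gen m n'))
| tensor_rel_bal m b n :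
    tensor_relation (gen (actr m b) n - gen m (actl b n)).

Definition tensor_relations : {pred {freeg (M * N)%type}} :=
  fun x => `[< tensor_relation x >].

Fact tensor_relations_zmod : zmod_closed tensor_relations.
Proof.
split=> [|x y /asboolP Rx /asboolP Ry]; apply/asboolP.
  exact: tensor_rel0.
exact: tensor_relB.
Qed.

HB.instance Definition _ :=
  GRing.isZmodClosed.Build _ tensor_relations tensor_relations_zmod.

Definition tensor : Type := Quotient.quot tensor_relations.

HB.instance Definition _ := GRing.Zmodule.on tensor.

Definition tens (m : M) (n : N) : tensor :=
  \pi_(Quotient.quot tensor_relations) (gen m n).

Lemma pi_tensor_eq (x y : {freeg (M * N)%type}) :
  tensor_relation (x - y) ->
  \pi_(Quotient.quot tensor_relations) x
    = \pi_(Quotient.quot tensor_relations) y.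
Proof. by move=> Rxy; apply/eqP; rewrite -Quotient.idealrBE; apply/asboolP. Qed.

Lemma tensDl m m' n : tens (m + m') n = tens m n + tens m' n.
Proof. by rewrite /tens -raddfD /=; apply/pi_tensor_eq/tensor_relDl. Qed.

Lemma tensDr m n n' : tens m (n + n') = tens m n + tens m n'.
Proof. by rewrite /tens -raddfD /=; apply/pi_tensor_eq/tensor_relDr. Qed.

Lemma tens_bal m b n : tens (actr m b) n = tens m (actl b n).
Proof. exact/pi_tensor_eq/tensor_rel_bal. Qed.

Lemma tens_ind (P : tensor -> Prop) :
  P 0 -> (forall x y, P x -> P y -> P (x + y)) -> (forall x, P x -> P (- x)) ->
  (forall m n, P (tens m n)) -> forall x, P x.
Proof.
move=> P0 PD PN Pt; elim/quotW=> D; rewrite -[D]freeg_sumE raddf_sum /=.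
elim/big_ind: _ => // [[m n] _]; set c := freeg.coeff _ _.
have Pn j : P (tens m n *+ j).
  by elim: j => [|j IHj]; rewrite ?mulr0n // mulrS; apply: PD.
rewrite -[c]intz -freegU_mulz raddfMz /= -/(tens m n).
by case: c => j; rewrite ?NegzE ?mulrNz; [|apply: PN]; apply: Pn.
Qed.

Section Lift.
Variables (V : zmodType) (f : M -> N -> V).

Definition balanced : Prop :=
  [/\ forall m m' n, f (m + m') n = f m n + f m' n,
      forall m n n', f m (n + n') = f m n + f m n'
    & forall m b n, f (actr m b) n = f m (actl b n)].

Let lift0 (x : {freeg (M * N)%type}) : V :=
  fglift (fun p => f p.1 p.2 : zmodule V) x.

Definition tensor_lift (x : tensor) : V := lift0 (generic_quotient.repr x).

Hypothesis f_bal : balanced.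

Let lift0B x y : lift0 (x - y) = lift0 x - lift0 y.
Proof. exact: (@lift_is_additive int _ (zmodule V)). Qed.

Let lift00 : lift0 0 = 0.
Proof. by have := lift0B 0 0; rewrite !subrr. Qed.

Let lift0N x : lift0 (- x) = - lift0 x.
Proof. by rewrite -[- x]sub0r lift0B lift00 sub0r. Qed.

Let lift0D x y : lift0 (x + y) = lift0 x + lift0 y.
Proof. by rewrite -{1}[y]opprK lift0B lift0N opprK. Qed.

Let lift0_gen m n : lift0 (gen m n) = f m n.
Proof. by rewrite /lift0 freeg.liftU scale1r. Qed.

Let lift0_rel x : tensor_relation x -> lift0 x = 0.
Proof.
have [fDl fDr fb] := f_bal.
elim=> [|y z _ y0 _ z0|m m' n|m n n'|m b n]; first exact: lift00.
- by rewrite lift0B y0 z0 subrr.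
- by rewrite lift0B lift0D !lift0_gen fDl subrr.
- by rewrite lift0B lift0D !lift0_gen fDr subrr.
- by rewrite lift0B !lift0_gen fb subrr.
Qed.

Let tensor_lift_pi x :
  tensor_lift (\pi_(Quotient.quot tensor_relations) x) = lift0 x.
Proof.
apply/eqP; rewrite -subr_eq0 -lift0B lift0_rel //; apply/asboolP.
by rewrite -[asbool _]/(_ \in tensor_relations) Quotient.idealrBE reprK.
Qed.

Lemma tensor_liftE m n : tensor_lift (tens m n) = f m n.
Proof. by rewrite tensor_lift_pi lift0_gen. Qed.

Lemma tensor_liftD x y : tensor_lift (x + y) = tensor_lift x + tensor_lift y.
Proof.
elim/quotW: x => x; elim/quotW: y => y.
by rewrite -raddfD /= !tensor_lift_pi lift0D.
Qed.

End Lift.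

Lemma tensor_hom_eq (V : zmodType) (g h : tensor -> V) :
  (forall x y, g (x + y) = g x + g y) -> (forall x y, h (x + y) = h x + h y) ->
  (forall m n, g (tens m n) = h (tens m n)) -> g =1 h.
Proof.
move=> gD hD gh.
have g0 : g 0 = 0 by apply: (addIr (g 0)); rewrite -gD !add0r.
have h0 : h 0 = 0 by apply: (addIr (h 0)); rewrite -hD !add0r.
elim/tens_ind=> [|x y Px Py|x Px|m n]; rewrite ?g0 ?h0 ?gD ?hD ?Px ?Py //.
by apply: (addIr (g x)); rewrite {2}Px -gD -hD !addNr g0 h0.
Qed.

Fact actl_balanced (a : A) : balanced (fun m n => tens (actl a m) n).
Proof.
split=> [m m' n|m n n'|m b n]; first by rewrite actlDr tensDl.
  by rewrite tensDr.
by rewrite actlrA tens_bal.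
Qed.

Fact actr_balanced (c : C) : balanced (fun m n => tens m (actr n c)).
Proof.
split=> [m m' n|m n n'|m b n]; first by rewrite tensDl.
  by rewrite actrDl tensDr.
by rewrite tens_bal actlrA.
Qed.

Definition tensor_actl (a : A) : tensor -> tensor :=
  tensor_lift (fun m n => tens (actl a m) n).
Definition tensor_actr (x : tensor) (c : C) : tensor :=
  tensor_lift (fun m n => tens m (actr n c)) x.

Lemma tensor_actlE a m n : tensor_actl a (tens m n) = tens (actl a m) n.
Proof. exact/tensor_liftE/actl_balanced. Qed.

Lemma tensor_actrE m n c : tensor_actr (tens m n) c = tens m (actr n c).
Proof. exact: (tensor_liftE (actr_balanced c)). Qed.

Fact tensor_actlDr a x y :
  tensor_actl a (x + y) = tensor_actl a x + tensor_actl a y.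
Proof. exact/tensor_liftD/actl_balanced. Qed.

Fact tensor_actrDl x y c :
  tensor_actr (x + y) c = tensor_actr x c + tensor_actr y c.
Proof. exact: (tensor_liftD (actr_balanced c)). Qed.

Fact tensor_actl1 x : tensor_actl 1 x = x.
Proof.
move: x; apply: tensor_hom_eq => // [x y|m n]; first exact: tensor_actlDr.
by rewrite tensor_actlE actl1.
Qed.

Fact tensor_actlA a a' x :
  tensor_actl a (tensor_actl a' x) = tensor_actl (a * a') x.
Proof.
move: x; apply: tensor_hom_eq => [x y|x y|m n]; rewrite ?tensor_actlDr //.
by rewrite !tensor_actlE actlA.
Qed.

Fact tensor_actlDl a a' x :
  tensor_actl (a + a') x = tensor_actl a x + tensor_actl a' x.
Proof.
move: x; apply: tensor_hom_eq => [x y|x y|m n]; rewrite ?tensor_actlDr //.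
  by rewrite addrACA.
by rewrite !tensor_actlE actlDl tensDl.
Qed.

Fact tensor_actr1 x : tensor_actr x 1 = x.
Proof.
move: x; apply: tensor_hom_eq => // [x y|m n]; first exact: tensor_actrDl.
by rewrite tensor_actrE actr1.
Qed.

Fact tensor_actrA x c c' :
  tensor_actr (tensor_actr x c) c' = tensor_actr x (c * c').
Proof.
move: x; apply: tensor_hom_eq => [x y|x y|m n]; rewrite ?tensor_actrDl //.
by rewrite !tensor_actrE actrA.
Qed.

Fact tensor_actrDr x c c' :
  tensor_actr x (c + c') = tensor_actr x c + tensor_actr x c'.
Proof.
move: x; apply: tensor_hom_eq => [x y|x y|m n]; rewrite ?tensor_actrDl //.
  by rewrite addrACA.
by rewrite !tensor_actrE actrDr tensDr.
Qed.

Fact tensor_actlrA a x c :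
  tensor_actl a (tensor_actr x c) = tensor_actr (tensor_actl a x) c.
Proof.
move: x; apply: tensor_hom_eq => [x y|x y|m n];
  rewrite ?(tensor_actrDl, tensor_actlDr) //.
by rewrite !(tensor_actrE, tensor_actlE).
Qed.

Fact tensor_actlr_central (c : k) x : tensor_actl c%:A x = tensor_actr x c%:A.
Proof.
move: x; apply: tensor_hom_eq => [x y|x y|m n].
- exact: tensor_actlDr.
- exact: tensor_actrDl.
by rewrite tensor_actlE tensor_actrE actlr_central tens_bal actlr_central.
Qed.

HB.instance Definition _ := @Zmodule_isBimodule.Build k A C tensor
  tensor_actl tensor_actr tensor_actl1 tensor_actlA tensor_actlDl tensor_actlDr
  tensor_actr1 tensor_actrA tensor_actrDl tensor_actrDr
  tensor_actlrA tensor_actlr_central.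

End Tensor.

Definition separably_equivalent (k : fieldType) (A B : falgType k) : Prop :=
  exists (M : bimodType A B) (N : bimodType B A)
         (X : bimodType A A) (Y : bimodType B B),
    [/\ two_sided_fgp M, two_sided_fgp N,
        bimod_iso (tensor M N) (regular_bimodule A * X)%type
      & bimod_iso (tensor N M) (regular_bimodule B * Y)%type].

Arguments separably_equivalent k A B : clear implicits.

(* Main.v *)
From HB Require Import structures.
Require Import Defs.
From mathcomp Require Import all_boot all_order all_fingroup all_algebra.
From mathcomp Require Import cyclic falgebra.
From mathcomp Require Import zify boolp.

Set Implicit Arguments.
Unset Strict Implicit.
Unset Printing Implicit Defensive.

Import GRing.Theory.
Local Open Scope ring_scope.

(** Over k[x]/(x^d), consider pairs (V, U) of a finite-dimensional module V and
a submodule U, that is, invariant subspaces of a nilpotent operator of index d.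
In characteristic 3 the group algebra of the cyclic group of order 3^n is
k[x]/(x^(3^n)), with x + 1 a generator of the group.  For d = 3 there are
finitely many indecomposable pairs, all with V of dimension at most 4, whereas
for d >= 6 there are indecomposable pairs of arbitrarily large dimension (the
classification of such pairs is due to Ringel and Schmidmeier).  A separable
equivalence transports the first property, so 3^n >= 6 excludes it.

The Krull-Schmidt theorem is bypassed by phrasing everything with ranks of
endomorphisms.  Over A = kC_3, the identity of every pair is a sum of
endomorphisms of the pair of rank at most 4 ([pair_decomposition]).
An isomorphism of the tensor product of N and M over A with B + Y gives an
element e = sum of n_i (x) m_i, with r terms, and a bimodule map to B that sends
e to 1.  For a pair (V, U) over B, pass to the A-module Hom_B(N, V) and its
submodule Hom_B(N, U), or rather to the parts spanned by the maps n |-> <n, m> v;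
decompose the identity there, and come back along e.  Hence the identity of
every pair over B is a sum of endomorphisms of rank at most 4r, where r does not
depend on the pair ([transfer_decomposition]).

Finally, for each m there is a pair over k[x]/(x^6) whose endomorphisms act on
a subquotient of dimension m + 1 through the commutant of a nilpotent Jordan
block; an endomorphism of rank at most m then acts there with a kernel, so it
kills the line annihilated by the block.  A sum of such endomorphisms kills it
too, and is not the identity ([tube_no_small_decomposition]).  Taking m = 4r
gives the contradiction. *)

(** * Linear maps and functionals *)

Lemma linfun_linear (k : fieldType) (V W : vectType k) (f : V -> W) :
  linear f -> linfun f =1 f.
Proof.
move=> f_lin.
pose fL : {linear V -> W} := HB.pack f (GRing.isLinear.Build _ _ _ _ f f_lin).
exact: (lfunE fL).
Qed.

Lemma lfun_of_linear (k : fieldType) (V W : vectType k) (f : V -> W) :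
  linear f -> exists F : 'Hom(V, W), F =1 f.
Proof. by move/linfun_linear; exists (linfun f). Qed.

Section LfunEquations.
Variables (k : fieldType) (V W : vectType k) (f : 'Hom(V, W)).

Lemma lfun_add u v : f (u + v) = f u + f v. Proof. exact: linearD. Qed.
Lemma lfun_sub u v : f (u - v) = f u - f v. Proof. exact: linearB. Qed.
Lemma lfun_scale c v : f (c *: v) = c *: f v. Proof. exact: linearZ. Qed.
Lemma lfun0 : f 0 = 0. Proof. exact: linear0. Qed.
Lemma lfun_sum I (r : seq I) (F : I -> V) :
  f (\sum_(i <- r) F i) = \sum_(i <- r) f (F i).
Proof. exact: linear_sum. Qed.
End LfunEquations.

Lemma rank1_lfun (k : fieldType) (V W : vectType k) (f : 'Hom(V, k^o)) (w : W) :
  exists F : 'Hom(V, W), forall v, F v = f v *: w.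
Proof.
apply: lfun_of_linear => c u v.
by rewrite lfun_add lfun_scale scalerDl -scalerA.
Qed.

Section Functionals.
Variables (k : fieldType) (T : vectType k).

Lemma functional_extend (f : 'Hom(T, k^o)) (Q H : {vspace T}) :
  (forall w, w \in Q -> w \in H -> f w = 0) ->
  exists g : 'Hom(T, k^o),
    {in Q, forall w, g w = f w} /\ {in H, forall w, g w = 0}.
Proof.
move=> fQH; exists (f \o addv_pi1 Q H)%VF; split=> w wP; rewrite comp_lfunE.
  have wE : addv_pi1 Q H w + addv_pi2 Q H w = w.
    by apply: addv_pi1_pi2; rewrite (subvP (addvSl _ _)).
  have p1Q : addv_pi1 Q H w \in Q by exact: memv_pi1.
  have p2Q : addv_pi2 Q H w \in Q.
    by rewrite -[addv_pi2 Q H w](addKr (addv_pi1 Q H w)) wE memvD ?memvN.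
  have: f (addv_pi1 Q H w + addv_pi2 Q H w)
          = f (addv_pi1 Q H w) + f (addv_pi2 Q H w) by exact: lfun_add.
  by rewrite wE (fQH (addv_pi2 Q H w)) ?addr0 ?memv_pi2.
have wE : addv_pi1 Q H w + addv_pi2 Q H w = w.
  by apply: addv_pi1_pi2; rewrite (subvP (addvSr _ _)).
rewrite addv_pi2_id // in wE.
have -> : addv_pi1 Q H w = 0 by apply: (addIr w); rewrite wE add0r.
exact: lfun0.
Qed.

Lemma functional_separate (v : T) (H : {vspace T}) :
  v \notin H ->
  exists f : 'Hom(T, k^o), f v = 1 /\ {in H, forall w, f w = 0}.
Proof.
move=> vH; have v_neq0 : v != 0 by apply: contraNneq vH => ->; rewrite mem0v.
have [f0 f0E] : exists f0 : 'Hom(T, k^o), f0 v = 1.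
  exists (linfun (coord [tuple v] ord0 : T -> k^o)).
  have v_free : free [tuple v] by rewrite seq1_free.
  by have := coord_free ord0 ord0 v_free; rewrite lfunE.
have [|f [fv fH]] := @functional_extend f0 <[v]> H.
  move=> _ /vlineP[c ->] cvH; have [->|c0] := eqVneq c 0.
    by rewrite scale0r lfun0.
  by case/negP: vH; rewrite -[v](scalerK c0) memvZ.
by exists f; rewrite fv ?memv_line.
Qed.
End Functionals.

(** * Invariant subspaces of operators of nilpotency index 3 *)

Section Splitting.
Variables (k : fieldType) (T : vectType k) (X : 'End(T)).
Implicit Types (P Q : {vspace T}) (e p : 'End(T)).

(** A pair of a module and a submodule over the polynomial ring, the variable
acting as X; both live in an ambient space T on which X need not be nilpotent. *)
Definition invariant_pair P Q : Prop :=
  [/\ (Q <= P)%VS, {in P, forall w, X w \in P} & {in Q, forall w, X w \in Q}].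

(** Only the values of e on P matter. *)
Definition pair_endo P Q e : Prop :=
  [/\ {in P, forall w, e w \in P}, {in Q, forall w, e w \in Q}
    & {in P, forall w, e (X w) = X (e w)}].

(** The pair is the direct sum of the images of p and 1 - p, and the former is
nonzero and small. *)
Definition splits_off P Q p : Prop :=
  [/\ pair_endo P Q p, {in P, forall w, p (p w) = p w}, (\dim (p @: P) <= 4)%N
    & exists2 w, w \in P & p w != 0].

Lemma iter_endoD j w w' : iter j X (w + w') = iter j X w + iter j X w'.
Proof. by elim: j => //= j ->; rewrite lfun_add. Qed.

Lemma iter_endoZ j c w : iter j X (c *: w) = c *: iter j X w.
Proof. by elim: j => //= j ->; rewrite lfun_scale. Qed.

Lemma iter_endo0 j : iter j X 0 = 0.
Proof. by elim: j => //= j ->; rewrite lfun0. Qed.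

Lemma iter_endo_mem P j w :
  {in P, forall u, X u \in P} -> w \in P -> iter j X w \in P.
Proof. by move=> XP wP; elim: j => //= j /XP. Qed.

Lemma iter_nilp d j w : iter d X w = 0 -> (d <= j)%N -> iter j X w = 0.
Proof. by move=> dw /subnK <-; rewrite iterD dw iter_endo0. Qed.

(** A functional that separates the socle of the cyclic module spanned by v from
H can be corrected, one power of X at a time, to vanish on the other iterates of
v: precomposing it with a power of X keeps it zero on H, which is X-stable. *)
Lemma dual_functional (H : {vspace T}) d v :
  {in H, forall w, X w \in H} -> iter d.+1 X v = 0 -> iter d X v \notin H ->
  exists f : 'Hom(T, k^o),
    [/\ f (iter d X v) = 1, {in H, forall w, f w = 0}
      & forall j, (j < d)%N -> f (iter j X v) = 0].
Proof.
move=> XH dv vH.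
suff /(_ d (leqnn d)) [f [fv fH fj]] : forall t, (t <= d)%N ->
  exists f : 'Hom(T, k^o), [/\ f (iter d X v) = 1, {in H, forall w, f w = 0}
      & forall j, (0 < j <= t)%N -> f (iter (d - j) X v) = 0].
  exists f; split=> // j jd; have := fj (d - j)%N.
  by rewrite subn_gt0 jd leq_subr subKn ?(ltnW jd) //; apply.
elim=> [_|t IHt td].
  have [f [fv fH]] := functional_separate vH.
  by exists f; split=> // -[].
have [f [fv fH fj]] := IHt (ltnW td).
pose c := f (iter (d - t.+1) X v).
have [|g gE] := @lfun_of_linear k T k^o (fun w => f w - c *: f (iter t.+1 X w)).
  move=> b u w; rewrite iter_endoD iter_endoZ !lfun_add !lfun_scale.
  by rewrite scalerBr !scalerDr opprD addrACA !scalerA [b * c]mulrC.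
exists g; split=> [|w wH|j /andP[j0]].
- rewrite gE fv -iterD (iter_nilp dv) ?lfun0 ?scaler0 ?subr0 //.
  by rewrite addSn ltnS leq_addl.
- by rewrite gE !fH ?scaler0 ?subr0 // iter_endo_mem.
rewrite leq_eqVlt => /orP[/eqP->|jt]; rewrite gE -iterD.
  by rewrite subnKC // fv /c [_ *: 1]mulr1 subrr.
rewrite fj ?j0 // (iter_nilp dv) ?lfun0 ?scaler0 ?subr0 //; lia.
Qed.

(** If X^(d+1) vanishes on P, a cyclic submodule C of length d + 1 is injective
among modules of that index, hence a summand of P.  With f as in
[dual_functional], the projection onto C sends w to the sum of the
f (X^(d-j) w) X^j v.  It maps Q into the intersection of C and Q as soon as f
kills X^(d+1-i) Q, where X^i v generates a submodule of Q; such an f exists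
because the socle of C is not in X^(d+1-i) Q. *)
Lemma cyclic_splits_off P Q d i v :
  invariant_pair P Q -> (d < 4)%N -> {in P, forall w, iter d.+1 X w = 0} ->
  (i <= d.+1)%N -> v \in P -> iter i X v \in Q ->
  (forall q, q \in Q -> iter d X v <> iter (d.+1 - i) X q) ->
  exists p, splits_off P Q p.
Proof.
move=> [QP XP XQ] d4 dP id vP viQ vQ.
have [H HE] : exists H : {vspace T},
    forall w, w \in H <-> exists2 q, q \in Q & w = iter (d.+1 - i) X q.
  have [|F FE] := @lfun_of_linear k T T (iter (d.+1 - i) X).
    by move=> c u w; rewrite iter_endoD iter_endoZ.
  exists (F @: Q)%VS => w; split=> [/memv_imgP[q qQ ->]|[q qQ ->]].
    by exists q; rewrite ?FE.
  by rewrite -FE memv_img.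
have [|||f [fv fH fj]] := @dual_functional H d v.
- move=> w /HE[q qQ ->]; apply/HE; exists (X q); first exact: XQ.
  by rewrite -iterS iterSr.
- exact: dP.
- by apply/negP => /HE[q qQ]; apply: vQ.
have [|p pE] := @lfun_of_linear k T T
    (fun w => \sum_(j < d.+1) f (iter (d - j) X w) *: iter j X v).
  move=> c u w; rewrite scaler_sumr -big_split; apply: eq_bigr => j _ /=.
  by rewrite iter_endoD iter_endoZ lfun_add lfun_scale scalerDl scalerA.
have vjP j : iter j X v \in P by exact: iter_endo_mem.
have pX : {in P, forall w, p (X w) = X (p w)}.
  move=> w wP; rewrite !pE lfun_sum /= big_ord_recl /= subn0 -iterSr dP //.
  rewrite lfun0 scale0r add0r [RHS]big_ord_recr /= lfun_scale /= -iterS dP //.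
  rewrite scaler0 addr0; apply: eq_bigr => j _; rewrite lfun_scale -iterSr.
  by congr (f (iter _ X w) *: _); rewrite /= /bump; have := ltn_ord j; lia.
have pv : p v = v.
  rewrite pE big_ord_recl /= subn0 fv scale1r big1 ?addr0 // => j _.
  by rewrite fj ?scale0r // /bump add1n ltn_subrL (leq_ltn_trans _ (ltn_ord j)).
have pvj j : p (iter j X v) = iter j X v.
  by elim: j => //= j IHj; rewrite pX ?IHj.
have v_neq0 : v != 0.
  apply: contra_eq_neq fv => v0.
  by rewrite v0 iter_endo0 lfun0 eq_sym oner_eq0.
exists p; split; last by exists v; rewrite ?pv.
- split=> // w wP; rewrite pE; apply: memv_suml => j _.
    by rewrite memvZ.
  have [ij|ji] := leqP i j.
    by rewrite memvZ // -(subnK ij) iterD (iter_endo_mem _ _ viQ).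
  rewrite fH ?scale0r ?mem0v //; apply/HE; exists (iter (i - j.+1) X w).
    exact: iter_endo_mem.
  by rewrite -iterD addnBA // subnK // subSS.
- move=> w wP; rewrite [p w]pE lfun_sum; apply: eq_bigr => j _.
  by rewrite lfun_scale /= pvj.
apply: leq_trans d4.
have <- : size [seq iter (nat_of_ord j) X v | j : 'I_d.+1] = d.+1.
  by rewrite size_map size_enum_ord.
apply: leq_trans (dim_span _); apply: dimvS.
apply/subvP => _ /memv_imgP[w wP ->].
rewrite pE; apply: memv_suml => j _.
by rewrite memvZ ?memv_span //; apply/mapP; exists j; rewrite ?mem_enum.
Qed.

(** The one indecomposable pair whose module is not cyclic: the module has Jordan
blocks v, X v, X^2 v and b, and the submodule is spanned by u = X v + b and
X u = X^2 v.  The coordinate functionals on the summand are f o X^2, f o X, f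
and g; the projection preserves Q because g agrees with f o X on Q, and it
commutes with X because g vanishes on X P.  These two demands on g are
compatible by the hypothesis on the w in P with X w in Q. *)
Lemma exceptional_splits_off P Q v u :
  invariant_pair P Q -> {in P, forall w, X (X (X w)) = 0} ->
  {in P, forall w, X (X w) \in Q} -> {in Q, forall w, X (X w) = 0} ->
  {in P, forall w, X w \in Q -> X (X w) = 0} ->
  v \in P -> u \in Q -> X u = X (X v) -> X (X v) != 0 ->
  exists p, splits_off P Q p.
Proof.
move=> [QP XP XQ] X3 X2Q Q2 XXQ vP uQ Xu Xv.
have QsubP w : w \in Q -> w \in P by apply: (subvP QP).
have [|||f [fv _ fj]] := @dual_functional 0%VS 2 v.
- by move=> w; rewrite !memv0 => /eqP->; rewrite lfun0.
- exact: X3.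
- by rewrite memv0.
have fv0 : f v = 0 := fj 0%N isT.
have fv1 : f (X v) = 0 := fj 1%N isT.
rewrite /= in fv; pose c := f (u - X v).
(* u is first changed within Q to make f vanish on b, then v to make g vanish
   on it; neither changes X v or X (X v). *)
pose u' := u - c *: X u; pose b := u' - X v.
have u'Q : u' \in Q by rewrite memvB ?memvZ ?XQ.
have Xu' : X u' = X (X v).
  by rewrite /u' lfun_add -scaleNr lfun_scale Q2 // scaler0 addr0.
have bP : b \in P by rewrite memvB ?XP // QsubP.
have Xb : X b = 0 by rewrite /b lfun_add Xu' -scaleN1r lfun_scale scaleN1r subrr.
have fb : f b = 0.
  rewrite /b /u' -addrA addrCA addrC lfun_add -/c Xu -scaleNr lfun_scale fv.
  by rewrite [_ *: _]mulr1 subrr.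
have [|g [gQ gX]] := @functional_extend k T (f \o X)%VF Q (X @: P).
  move=> _ /[swap] /memv_imgP[w wP ->] XwQ.
  by rewrite comp_lfunE XXQ ?lfun0.
have gX0 w : w \in P -> g (X w) = 0 by move=> wP; rewrite gX ?memv_img.
have gb : g b = 1.
  rewrite /b lfun_add -scaleN1r lfun_scale gX0 // scaler0 addr0 gQ //.
  by rewrite comp_lfunE Xu'.
pose v' := v - g v *: b.
have v'P : v' \in P by rewrite memvB ?memvZ.
have Xv' : X v' = X v.
  by rewrite /v' lfun_add -scaleNr lfun_scale Xb scaler0 addr0.
have fv' : f v' = 0.
  by rewrite /v' lfun_add -scaleNr lfun_scale fb scaler0 addr0.
have gv' : g v' = 0.
  by rewrite /v' lfun_add -scaleNr lfun_scale gb [_ *: _]mulr1 subrr.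
have bE : X v + b = u' by rewrite addrC subrK.
clearbody v' b u' => {c}.
have [F FE] := rank1_lfun f v'; have [F1 F1E] := rank1_lfun f (X v').
have [F2 F2E] := rank1_lfun f (X (X v')); have [G GE] := rank1_lfun g b.
have [p pE] : exists p : 'End(T), forall w, p w = f (X (X w)) *: v'
    + f (X w) *: X v' + f w *: X (X v') + g w *: b.
  exists ((F \o X \o X) + (F1 \o X) + F2 + G)%VF => w.
  by rewrite !add_lfunE !comp_lfunE FE F1E F2E GE.
have pX : {in P, forall w, p (X w) = X (p w)}.
  move=> w wP; rewrite !pE !(lfun_add, lfun_scale) X3 // lfun0 gX0 // Xb.
  by rewrite Xv' X3 // !scale0r !scaler0 add0r !addr0.
have pv : p v' = v'.
  by rewrite pE Xv' fv fv1 fv' gv' scale1r !scale0r !addr0.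
have pXv : p (X v') = X v' by rewrite pX ?pv.
have pXXv : p (X (X v')) = X (X v') by rewrite pX ?pXv ?XP.
have pb : p b = b.
  by rewrite pE Xb fb gb lfun0 !lfun0 scale1r !scale0r !add0r.
exists p; split; last first.
- exists v'; rewrite ?pv //.
  by apply: contraNneq Xv => v'0; rewrite -Xv' v'0 !lfun0.
- apply: (leq_trans _ (dim_span [:: v'; X v'; X (X v'); b])).
  apply: dimvS; apply/subvP => _ /memv_imgP[w wP ->].
  by rewrite pE !memvD // memvZ // memv_span // !inE eqxx ?orbT.
- by move=> w wP; rewrite [p w]pE !lfun_add !lfun_scale pv pXv pXXv pb.
split=> // w wP; first by rewrite pE !memvD // memvZ ?XP.
rewrite pE Q2 // lfun0 scale0r add0r -addrA addrCA memvD //.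
  by rewrite memvZ // Xv' X2Q.
by rewrite gQ // comp_lfunE -scalerDr Xv' bE memvZ.
Qed.

(** Suppose that no cyclic pair splits off.  For index 3, the four positions i of
the submodule in a cyclic module force X^2 P to be in Q, X^2 Q = 0, X^2 w = 0
whenever w in P has X w in Q, and X^2 P to be in X Q.  Unless X^2 P = 0, this is the
exceptional case.  When X^2 P = 0, the same reasoning for index 2 and then index 1
gives X P = 0 and P = 0. *)
Lemma pair_splits_off P Q :
  invariant_pair P Q -> {in P, forall w, X (X (X w)) = 0} -> P != 0%VS ->
  exists p, splits_off P Q p.
Proof.
move=> PQ X3 P_neq0; have [QP XP XQ] := PQ; apply: contrapT => no_split.
have QsubP w : w \in Q -> w \in P by apply: (subvP QP).
have cyc d i v : (d < 4)%N -> {in P, forall w, iter d.+1 X w = 0} ->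
    (i <= d.+1)%N -> v \in P -> iter i X v \in Q ->
    exists2 q, q \in Q & iter d X v = iter (d.+1 - i) X q.
  move=> d4 dP id vP viQ; apply: contrapT => no_q; apply: no_split.
  apply: (cyclic_splits_off PQ d4 dP id vP viQ) => q qQ vq.
  by apply: no_q; exists q.
have X2Q : {in P, forall w, X (X w) \in Q}.
  by move=> w wP; have [|||||q qQ /= ->] := cyc 2 3 w; rewrite //= X3 ?mem0v.
have Q2 : {in Q, forall q, X (X q) = 0}.
  move=> q qQ; have [|||||q' q'Q /= ->] := cyc 2 0 q; rewrite ?QsubP //.
  by rewrite X3 ?QsubP.
have XXQ : {in P, forall w, X w \in Q -> X (X w) = 0}.
  by move=> w wP XwQ; have [|||||q qQ /= ->] := cyc 2 1 w; rewrite // Q2.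
have X2 : {in P, forall w, X (X w) = 0}.
  move=> v vP; have [|||||u uQ /= Xvu] := cyc 2 2 v; rewrite //= ?X2Q //.
  have [//|Xv] := eqVneq (X (X v)) 0; case: no_split.
  exact: (exceptional_splits_off PQ X3 X2Q Q2 XXQ vP uQ (esym Xvu) Xv).
have X1Q : {in P, forall w, X w \in Q}.
  by move=> w wP; have [|||||q qQ /= ->] := cyc 1 2 w; rewrite //= X2 ?mem0v.
have Q1 : {in Q, forall q, X q = 0}.
  move=> q qQ; have [|||||q' q'Q /= ->] := cyc 1 0 q; rewrite ?QsubP //.
  by rewrite Q2.
have X1 : {in P, forall w, X w = 0}.
  move=> w wP; have [|||||q qQ /= ->] := cyc 1 1 w; rewrite //= ?X1Q //.
  exact: Q1.
case/negP: P_neq0; rewrite -subv0; apply/subvP => w wP.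
have wQ : w \in Q.
  by have [|||||q qQ /= ->] := cyc 0 1 w; rewrite //= X1 ?mem0v.
by have [|||||q qQ /= ->] := cyc 0 0 w; rewrite // Q1 ?mem0v.
Qed.

Lemma pair_decomposition P Q :
  invariant_pair P Q -> {in P, forall w, X (X (X w)) = 0} ->
  exists2 es : seq 'End(T),
    forall e, e \in es -> pair_endo P Q e /\ (\dim (e @: P) <= 4)%N
  & {in P, forall w, w = \sum_(e <- es) e w}.
Proof.
have [n] := ubnP (\dim P); elim: n P Q => // n IHn P Q Pn PQ X3.
have [->|P_neq0] := eqVneq P 0%VS.
  by exists [::] => // w; rewrite memv0 => /eqP ->; rewrite big_nil.
have [p [pPQ pp pdim [w0 w0P pw0]]] := pair_splits_off PQ X3 P_neq0.
have [QP XP XQ] := PQ; have [pP pQ pX] := pPQ.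
have QsubP w : w \in Q -> w \in P by apply: (subvP QP).
pose P2 := (P :&: lker p)%VS; pose Q2 := (Q :&: lker p)%VS.
have P2P w : w \in P2 -> w \in P by case/memv_capP.
have compP2 w : w \in P -> w - p w \in P2.
  move=> wP; rewrite memv_cap memvB ?pP // memv_ker.
  by rewrite -scaleN1r lfun_add lfun_scale pp // scaleN1r subrr eqxx.
have compQ2 w : w \in Q -> w - p w \in Q2.
  move=> wQ; rewrite memv_cap memvB ?pQ //.
  by have /memv_capP[] := compP2 w (QsubP w wQ).
have kerX w : w \in P -> w \in lker p -> X w \in lker p.
  by move=> wP; rewrite !memv_ker => /eqP pw; rewrite pX // pw lfun0.
have [|||es es_endo es_sum] := IHn P2 Q2.
- rewrite (leq_trans _ (Pn : (\dim P <= n)%N)) //.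
  rewrite ltnNge; apply: contra pw0 => dimP.
  have : P2 == P by rewrite eqEdim capvSl.
  move=> /eqP P2E; rewrite -P2E in w0P.
  by case/memv_capP: w0P => _; rewrite memv_ker.
- split.
  + by rewrite /Q2 /P2 capvS.
  + by move=> w /memv_capP[wP wp]; rewrite memv_cap XP ?kerX.
  + by move=> w /memv_capP[wQ wp]; rewrite memv_cap XQ ?kerX ?QsubP.
- by move=> w /P2P; apply: X3.
exists (p :: [seq (e \o (\1 - p))%VF | e <- es]) => [e|w wP]; last first.
  rewrite big_cons big_map -[LHS](subrKC (p w)); congr (_ + _).
  rewrite {1}(es_sum _ (compP2 _ wP)); apply: eq_bigr => e _.
  by rewrite comp_lfunE add_lfunE opp_lfunE id_lfunE.
rewrite inE => /predU1P[->|/mapP[{}e /es_endo[[eP eQ eX] edim] ->]]; first by [].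
have eE w : (e \o (\1 - p))%VF w = e (w - p w).
  by rewrite comp_lfunE add_lfunE opp_lfunE id_lfunE.
split.
  split=> w wP; rewrite !eE.
  - by rewrite P2P ?eP ?compP2.
  - by have /eQ/memv_capP[] := compQ2 w wP.
  - by rewrite pX // -eX ?compP2 // (lfun_sub X).
apply: leq_trans edim; apply: dimvS; apply/subvP => _ /memv_imgP[w wP ->].
by rewrite eE memv_img ?compP2.
Qed.
End Splitting.

(** * Tensor products and direct summands *)

Section TensorSums.
Variables (k : fieldType) (A B C : algType k).
Variables (N : bimodType B A) (M : bimodType A C).

Lemma tensNl (n : N) (m : M) : tens (- n) m = - tens n m.
Proof.
have tens0 : tens (0 : N) m = 0.
  by apply: (addrI (tens 0 m)); rewrite -tensDl !addr0.
by apply: (addrI (tens n m)); rewrite -tensDl !subrr.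
Qed.

Lemma tensor_sum (t : tensor N M) :
  exists s : seq (N * M), t = \sum_(x <- s) tens x.1 x.2.
Proof.
elim/tens_ind: t => [|_ _ [s ->] [s' ->]|_ [s ->]|n m].
- by exists [::]; rewrite big_nil.
- by exists (s ++ s'); rewrite big_cat.
- exists [seq (- x.1, x.2) | x <- s]; rewrite big_map -sumrN.
  by apply: eq_bigr => x _; rewrite tensNl.
by exists [:: (n, m)]; rewrite big_seq1.
Qed.
End TensorSums.

(** The element e is the preimage of 1; it is central because 1 is. *)
Lemma regular_summand (k : fieldType) (B : algType k) (Z Y : bimodType B B) :
  bimod_iso Z (regular_bimodule B * Y)%type ->
  exists (p : Z -> B) (e : Z),
    [/\ forall z z', p (z + z') = p z + p z',
        forall b z, p (actl b z) = b * p z,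
        forall z b, p (actr z b) = p z * b,
        p e = 1 & forall b, actl b e = actr e b].
Proof.
case=> f [[g fK gK] fD fl fr]; exists (fun z => (f z).1), (g (1, 0)).
split=> [z z'|b z|z b||b]; rewrite ?fD ?fl ?fr ?gK //.
apply: (can_inj fK); rewrite fl fr gK.
have act0l b' : actl b' 0 = 0 :> Y.
  by apply: (addrI (actl b' 0)); rewrite -actlDr !addr0.
have act0r b' : actr (0 : Y) b' = 0.
  by apply: (addrI (actr 0 b')); rewrite -actrDl !addr0.
congr (_, _); last by rewrite /= act0l act0r.
by rewrite /= /actl /actr /= mulr1 mul1r.
Qed.

Definition representation (k : fieldType) (B : algType k) (V : vectType k)
    (rho : B -> 'End(V)) : Prop :=
  [/\ forall b b', rho (b + b') = rho b + rho b',
      forall b b', rho (b * b') = (rho b \o rho b')%VF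
    & forall c : k, rho c%:A = c *: \1%VF].

(** * Transfer of decompositions along a bimodule summand *)

(** Here [beta n m] stands for the image of the tensor of n and m under a bimodule
map to B, and x generates A as an algebra; A is kC_3 in the application and
x + 1 a generator of the group. *)
Section Transfer.
Variables (k : fieldType) (A B : algType k).
Variables (N : bimodType B A) (M : bimodType A B) (beta : N -> M -> B).
Hypothesis betaDl : forall n n' m, beta (n + n') m = beta n m + beta n' m.
Hypothesis betaDr : forall n m m', beta n (m + m') = beta n m + beta n m'.
Hypothesis beta_actl : forall b n m, beta (actl b n) m = b * beta n m.
Hypothesis beta_actr : forall n m b, beta n (actr m b) = beta n m * b.
Hypothesis beta_bal : forall n a m, beta (actr n a) m = beta n (actl a m).

Variables (g h : nat) (nu : 'I_g -> N) (mu : 'I_h -> M).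
Variables (nu_coef : N -> 'I_g -> B) (mu_coef : M -> 'I_h -> B).
Hypothesis nuE : forall n, n = \sum_i actl (nu_coef n i) (nu i).
Hypothesis muE : forall m, m = \sum_i actr (mu i) (mu_coef m i).

Variables (x : A).
Hypothesis x_nil : x ^+ 3 = 0.
Hypothesis x_gen : forall S : A -> Prop,
  S 1 -> (forall a a', S a -> S a' -> S (a + a')) ->
  (forall (c : k) a, S a -> S (c *: a)) -> (forall a, S a -> S (a * x)) ->
  forall a, S a.

Variables (V : vectType k) (rho : B -> 'End(V)) (U : {vspace V}).
Hypothesis rho_rep : representation rho.
Hypothesis rhoU : forall b, {in U, forall u, rho b u \in U}.

Local Notation W := {ffun 'I_g -> V}.
Implicit Types (n : N) (m : M) (v : V) (w : W).

Let rhoD b b' v : rho (b + b') v = rho b v + rho b' v.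
Proof. by have [-> _ _] := rho_rep; rewrite add_lfunE. Qed.
Let rhoM b b' v : rho (b * b') v = rho b (rho b' v).
Proof. by have [_ -> _] := rho_rep; rewrite comp_lfunE. Qed.
Let rhoC c v : rho c%:A v = c *: v.
Proof. by have [_ _ ->] := rho_rep; rewrite scale_lfunE id_lfunE. Qed.
Let rho0 v : rho 0 v = 0.
Proof. by rewrite -(scale0r 1) rhoC scale0r. Qed.
Let rho_sum I (r : seq I) (F : I -> B) v :
  rho (\sum_(i <- r) F i) v = \sum_(i <- r) rho (F i) v.
Proof. by elim/big_rec2: _ => [|i b v' _ <-]; rewrite ?rho0 ?rhoD. Qed.

Let beta0l m : beta 0 m = 0.
Proof. by apply: (addrI (beta 0 m)); rewrite -betaDl !addr0. Qed.
Let beta0r n : beta n 0 = 0.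
Proof. by apply: (addrI (beta n 0)); rewrite -betaDr !addr0. Qed.
Let beta_suml I (r : seq I) (F : I -> N) m :
  beta (\sum_(i <- r) F i) m = \sum_(i <- r) beta (F i) m.
Proof. by elim/big_rec2: _ => [|i b v' _ <-]; rewrite ?beta0l ?betaDl. Qed.

(* The map n |-> rho (beta n m) v from N to V, B-linear in n, is encoded by its
   values on the generators nu; W contains Hom_B(N, V) in this way.  On elements
   of Hom_B(N, V), [eval n] is evaluation at n and [Xact] is the action of x
   coming from the right action on N; elsewhere both depend on the choice of
   the coefficients nu_coef. *)
Let hom_of m : 'Hom(V, W) :=
  linfun (fun v => [ffun i => rho (beta (nu i) m) v] : W).
Let eval n : 'Hom(W, V) := linfun (fun w => \sum_i rho (nu_coef n i) (w i)).
Let Xact : 'End(W) := linfun (fun w => [ffun i => eval (actr (nu i) x) w] : W).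
Let homs (S : {vspace V}) : {vspace W} := (\sum_l (hom_of (mu l) @: S))%VS.
Let P := homs fullv.
Let Q := homs U.

Let hom_ofE m v i : hom_of m v i = rho (beta (nu i) m) v.
Proof.
rewrite linfun_linear ?ffunE // => c u u'.
by apply/ffunP => j; rewrite !ffunE lfun_add lfun_scale.
Qed.

Let evalE n w : eval n w = \sum_i rho (nu_coef n i) (w i).
Proof.
rewrite linfun_linear // => c u u'; rewrite scaler_sumr -big_split.
by apply: eq_bigr => j _; rewrite !ffunE lfun_add lfun_scale.
Qed.

Let XactE w i : Xact w i = eval (actr (nu i) x) w.
Proof.
rewrite linfun_linear ?ffunE // => c u u'.
by apply/ffunP => j; rewrite !ffunE lfun_add lfun_scale.
Qed.

Let eval_hom n m v : eval n (hom_of m v) = rho (beta n m) v.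
Proof.
rewrite [n in RHS]nuE beta_suml rho_sum evalE; apply: eq_bigr => i _.
by rewrite hom_ofE beta_actl rhoM.
Qed.

Let hom_ofD m m' v : hom_of (m + m') v = hom_of m v + hom_of m' v.
Proof. by apply/ffunP => i; rewrite !ffunE !hom_ofE betaDr rhoD. Qed.

Let hom_of_actr m b v : hom_of (actr m b) v = hom_of m (rho b v).
Proof. by apply/ffunP => i; rewrite !hom_ofE beta_actr rhoM. Qed.

Let beta_scaler n c m : beta n (actl c%:A m) = c%:A * beta n m.
Proof. by rewrite -beta_bal -actlr_central beta_actl. Qed.

Let hom_of_scale m c v : hom_of (actl c%:A m) v = c *: hom_of m v.
Proof. by apply/ffunP => i; rewrite !ffunE !hom_ofE beta_scaler rhoM rhoC. Qed.

Let Xact_hom m v : Xact (hom_of m v) = hom_of (actl x m) v.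
Proof. by apply/ffunP => i; rewrite XactE eval_hom hom_ofE beta_bal. Qed.

(* The generators mu of M as a right B-module suffice, since m b and v give the
   same map as m and b v. *)
Let hom_of_mem (S : {vspace V}) m v :
  (forall b, {in S, forall u, rho b u \in S}) ->
  v \in S -> hom_of m v \in homs S.
Proof.
move=> rhoS vS; rewrite [m]muE.
have -> : hom_of (\sum_i actr (mu i) (mu_coef m i)) v
        = \sum_i hom_of (mu i) (rho (mu_coef m i) v).
  elim/big_rec2: _ => [|i w m' _ <-]; last by rewrite hom_ofD hom_of_actr.
  by apply/ffunP => i; rewrite hom_ofE beta0r rho0 ffunE.
by apply: memv_sumr => i _; rewrite memv_img ?rhoS.
Qed.

Let hom_of_P m v : hom_of m v \in P.
Proof. by apply: hom_of_mem; rewrite ?memvf // => b u _; rewrite memvf. Qed.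

Let hom_of_Q m u : u \in U -> hom_of m u \in Q.
Proof. exact: hom_of_mem. Qed.

Let homs_sub (Z : vectType k) (F : 'Hom(W, Z)) (S : {vspace V}) (R : {vspace Z}) :
  (forall m, {in S, forall v, F (hom_of m v) \in R}) ->
  {in homs S, forall w, F w \in R}.
Proof.
move=> FR w; rewrite memv_preim; apply/subvP/subv_sumP => l _.
by apply/subvP => _ /memv_imgP[v vS ->]; rewrite -memv_preim FR.
Qed.

Let homs_ext (Z : vectType k) (F G : 'Hom(W, Z)) :
  (forall m v, F (hom_of m v) = G (hom_of m v)) -> {in P, F =1 G}.
Proof.
move=> FG w wP; apply/eqP; rewrite -subr_eq0 -opp_lfunE -add_lfunE -memv0.
apply: (homs_sub _ wP) => m v _.
by rewrite add_lfunE opp_lfunE FG subrr memv0.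
Qed.

Let Xact_pair : invariant_pair Xact P Q.
Proof.
split.
- apply/subv_sumP => l _.
  by rewrite (subv_trans _ (sumv_sup l _ (subvv _))) ?limgS ?subvf.
- by apply: homs_sub => m v _; rewrite Xact_hom hom_of_P.
- by apply: homs_sub => m u uU; rewrite Xact_hom hom_of_Q.
Qed.

Let Xact_nil : {in P, forall w, Xact (Xact (Xact w)) = 0}.
Proof.
move=> w wP; rewrite -[RHS](zero_lfunE _ w) -!comp_lfunE.
apply: homs_ext wP => m v; rewrite !comp_lfunE !Xact_hom !actlA.
rewrite zero_lfunE.
have -> : x * x * x = 0 by rewrite -x_nil !exprSr expr0 mul1r.
have -> : (0 : A) = 0%:A by rewrite scale0r.
by rewrite hom_of_scale scale0r.
Qed.

Section Endo.
Variable (e : 'End(W)).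
Hypothesis eP : pair_endo Xact P Q e.

Let e_mem w : w \in P -> e w \in P. Proof. by have [+ _ _] := eP; apply. Qed.

Let eval_ext n n' n'' w :
  (forall m, beta n m = beta n' m + beta n'' m) -> w \in P ->
  eval n w = eval n' w + eval n'' w.
Proof.
move=> bn wP; rewrite -add_lfunE; apply: homs_ext wP => m v.
by rewrite add_lfunE !eval_hom bn rhoD.
Qed.

(** The endomorphism e commutes with x, which generates A, hence with A.  The
identity is proved by induction along this generation. *)
Lemma eval_balanced a n m v :
  eval (actr n a) (e (hom_of m v)) = eval n (e (hom_of (actl a m) v)).
Proof.
elim/x_gen: a n m => [|a a' IHa IHa'|c a IHa|a IHa] n m.
- by rewrite actr1 actl1.
- rewrite actlDl hom_ofD !lfun_add -IHa -IHa'.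
  by apply: eval_ext; rewrite ?e_mem // => m'; rewrite actrDr betaDl.
- rewrite -mulr_algl -actlA hom_of_scale !lfun_scale -IHa -actrA -actlr_central.
  rewrite -actlrA -scale_lfunE.
  apply: homs_ext (e_mem (hom_of_P _ _)) => m' v'.
  by rewrite scale_lfunE !eval_hom beta_actl rhoM rhoC.
have eX w : w \in P -> e (Xact w) = Xact (e w) by have [_ _ +] := eP; apply.
rewrite -actrA -actlA -IHa -Xact_hom eX // -[RHS]comp_lfunE.
apply: homs_ext (e_mem (hom_of_P _ _)) => m' v'.
by rewrite comp_lfunE Xact_hom !eval_hom beta_bal.
Qed.

Lemma casimir_balanced v : balanced (fun n m => eval n (e (hom_of m v))).
Proof.
split=> [n n' m|n m m'|n a m].
- by apply: eval_ext; rewrite ?e_mem // => m'; rewrite betaDl.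
- by rewrite hom_ofD !lfun_add.
- exact: eval_balanced.
Qed.

(** For s listing the terms of a central element e0 of the tensor product, this is
the composite of V -> Hom_B(N, V), e and the way back, both legs being given
by e0. *)
Definition transferred (s : seq (N * M)) : 'End(V) :=
  \sum_(y <- s) (eval y.1 \o e \o hom_of y.2)%VF.

Lemma transferredE s v :
  transferred s v = \sum_(y <- s) eval y.1 (e (hom_of y.2 v)).
Proof. by rewrite sum_lfunE; apply: eq_bigr => y _; rewrite !comp_lfunE. Qed.

(** By balancedness, the value of [transferred s] at v is the value at t of an
additive map H v defined on the tensor product.  Acting by b on v amounts to
acting by b on t from the right, and acting on the value amounts to acting on t
from the left. *)
Lemma transferred_comm s b v :
  let t := \sum_(y <- s) tens y.1 y.2 in actl b t = actr t b ->
  transferred s (rho b v) = rho b (transferred s v).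
Proof.
move=> t tb; pose H v' := tensor_lift (fun n m => eval n (e (hom_of m v'))).
have HD v' z z' : H v' (z + z') = H v' z + H v' z'.
  exact: (tensor_liftD (casimir_balanced v')).
have H0 v' : H v' 0 = 0 by apply: (addrI (H v' 0)); rewrite -HD !addr0.
have HE v' : transferred s v' = H v' t.
  rewrite transferredE /t; elim/big_rec2: _ => [|y v1 z _ ->]; first by rewrite H0.
  by rewrite HD /H tensor_liftE //; apply: casimir_balanced.
have Hr z : H (rho b v) z = H v (actr z b).
  move: z; apply: tensor_hom_eq => [z z'|z z'|n m]; rewrite ?actrDl ?HD //.
  have -> : actr (tens n m) b = tens n (actr m b) by apply: tensor_actrE.
  rewrite /H !tensor_liftE; try exact: casimir_balanced.
  by rewrite hom_of_actr.
have Hl z : rho b (H v z) = H v (actl b z).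
  move: z; apply: tensor_hom_eq => [z z'|z z'|n m].
  - by rewrite HD lfun_add.
  - by rewrite actlDr HD.
  have -> : actl b (tens n m) = tens (actl b n) m by apply: tensor_actlE.
  rewrite /H !tensor_liftE; try exact: casimir_balanced.
  rewrite -comp_lfunE; apply: homs_ext (e_mem (hom_of_P _ _)) => m' v'.
  by rewrite comp_lfunE !eval_hom beta_actl rhoM.
by rewrite !HE Hl tb -Hr.
Qed.

Lemma transferred_stable s : {in U, forall u, transferred s u \in U}.
Proof.
move=> u uU; rewrite transferredE; apply: memv_suml => y _.
have eQ w : w \in Q -> e w \in Q by have [_ + _] := eP; apply.
apply: (homs_sub _ (eQ _ (hom_of_Q y.2 uU))) => m u' u'U.
by rewrite eval_hom rhoU.
Qed.

(** Each term of the sum factors through the image of e. *)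
Lemma transferred_rank s d : (\dim (e @: P) <= d)%N ->
  (\dim (limg (transferred s)) <= d * size s)%N.
Proof.
move=> ed; apply: (@leq_trans (\dim (\sum_(y <- s) (eval y.1 @: (e @: P)))%VS)).
  apply/dimvS/subvP => _ /memv_imgP[v _ ->]; rewrite transferredE.
  elim: s => [|y s IHs]; first by rewrite !big_nil mem0v.
  by rewrite !big_cons memv_add // memv_img // memv_img.
apply: leq_trans (dimv_leq_sum _ _ _) _.
rewrite -sum1_size big_distrr /= leq_sum // => y _; rewrite muln1.
by apply: leq_trans ed; rewrite -[leqRHS](limg_ker_dim (eval y.1)) leq_addl.
Qed.
End Endo.

(** Transferring the identity of Hom_B(N, V) gives the action of the image of t
in B, which is 1; so the decomposition of the former transfers to one of the
identity of V. *)
Lemma transfer_decomposition (s : seq (N * M)) :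
  let t := \sum_(y <- s) tens y.1 y.2 in
  (forall b, actl b t = actr t b) -> \sum_(y <- s) beta y.1 y.2 = 1 ->
  exists2 phis : seq 'End(V),
    forall phi, phi \in phis ->
      [/\ forall b v, phi (rho b v) = rho b (phi v),
          {in U, forall u, phi u \in U} & (\dim (limg phi) <= 4 * size s)%N]
  & forall v, v = \sum_(phi <- phis) phi v.
Proof.
move=> t tb t1; have [es es_endo es_sum] := pair_decomposition Xact_pair Xact_nil.
exists [seq transferred e s | e <- es] => [phi /mapP[e /es_endo[eP edim] ->]|v].
  split; [move=> b v|exact: transferred_stable|exact: transferred_rank].
  exact: transferred_comm.
rewrite big_map; under eq_bigr do rewrite transferredE.
rewrite exchange_big /= -[LHS](scale1r v) -rhoC scale1r -t1 rho_sum.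
apply: eq_bigr => y _; rewrite -eval_hom (es_sum _ (hom_of_P y.2 v)).
by rewrite lfun_sum -es_sum.
Qed.
End Transfer.

(** * Large indecomposable pairs of nilpotency index 6 *)

Section Shift.
Variables (k : fieldType) (m : nat).
Local Notation S := 'rV[k]_m.+1.

Definition shift_row (s : S) : S :=
  \row_i (if (i < m)%N then s 0 (inord i.+1) else 0).

Lemma shift_row_linear : linear shift_row.
Proof.
move=> c u v; apply/rowP => i; rewrite !mxE.
by case: ifP; rewrite ?mxE ?mulr0 ?addr0.
Qed.

Definition shift : 'End(S) := linfun shift_row.

Lemma shiftE s : shift s = shift_row s.
Proof. exact: (linfun_linear shift_row_linear). Qed.

(** Applying the shift repeatedly to a nonzero vector of the kernel of al ends at a
nonzero multiple of the basis vector that spans the kernel of the shift. *)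
Lemma shift_commutant (al : 'End(S)) :
  (forall s, al (shift s) = shift (al s)) -> lker al != 0%VS ->
  al (delta_mx 0 0) = 0.
Proof.
move=> al_shift; rewrite -subv0 => /subvPn[s].
rewrite memv_ker memv0 => /eqP als s0.
have [i si] : exists i, s 0 i != 0.
  apply/existsP; apply: contraNT s0; rewrite negb_exists => /forallP s_eq0.
  by apply/eqP/rowP => i; rewrite mxE; apply/eqP/negbNE/s_eq0.
case: (arg_maxnP (fun j => val j) (si : (fun j => s 0 j != 0) i)).
move=> {si}i /= si s_max {s0}.
have {}s_max (j : 'I_m.+1) : (i < j)%N -> s 0 j = 0.
  by move=> ij; apply/eqP; apply: contraTT ij => /s_max; rewrite -leqNgt.
have [d id] : {d | nat_of_ord i = d} by exists i.
elim: d => [|d IHd] in s i als si s_max id *.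
  have sE : s = s 0 i *: delta_mx 0 0.
    apply/rowP => j; rewrite !mxE /=; have [->|j0] := eqVneq j 0.
      by rewrite mulr1; congr (s 0 _); apply: val_inj.
    by rewrite mulr0 s_max // id lt0n.
  apply: (scalerI si); rewrite scaler0 -lfun_scale -sE; exact: als.
have dm' : (d < m)%N by rewrite -ltnS -id.
have dm : (d < m.+1)%N by apply: ltnW.
have iE : i = inord d.+1 by apply: ord_inj; rewrite id inordK.
apply: (IHd (shift s) (Ordinal dm)) => //.
- by rewrite al_shift als lfun0.
- by rewrite shiftE mxE /= dm' -iE.
move=> j /= dj; rewrite shiftE mxE; case: ifP => // jm.
by rewrite s_max // id inordK.
Qed.
End Shift.

Section Tube.
Variables (k : fieldType) (m : nat).
Local Notation S := 'rV[k]_m.+1.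
Local Notation V := {ffun 'I_12 -> S}.
Implicit Types (v w : V) (s : S).

(** The space V is the module with Jordan blocks of sizes 6, 4 and 2, tensored
with S: coordinates 0 to 5, 6 to 9 and 10 to 11 are the coefficients of the
successive powers of the nilpotent operator Y applied to three generators
E1, E2, E3. *)
Definition co (j : nat) (v : V) : S := v (inord j).

Lemma co_lin j c v w : co j (c *: v + w) = c *: co j v + co j w.
Proof. by rewrite /co !ffunE. Qed.

Lemma coD j v w : co j (v + w) = co j v + co j w.
Proof. by rewrite /co ffunE. Qed.

Lemma co0 j : co j 0 = 0.
Proof. by rewrite /co ffunE. Qed.

Lemma co_inj v w : (forall j, (j < 12)%N -> co j v = co j w) -> v = w.
Proof. by move=> vw; apply/ffunP => i; rewrite -(inord_val i) -!/(co i _) vw. Qed.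

Definition tube_step (v : V) : V :=
  [ffun i : 'I_12 => if val i \in [:: 0; 6; 10]%N then 0 else co i.-1 v].

Lemma tube_step_linear : linear tube_step.
Proof.
move=> c v w; apply/ffunP => i; rewrite !ffunE.
by case: ifP; rewrite ?co_lin ?scaler0 ?addr0.
Qed.

Definition tube_nilp : 'End(V) := linfun tube_step.

Lemma co_nilp j v : (j < 12)%N ->
  co j (tube_nilp v) = if j \in [:: 0; 6; 10]%N then 0 else co j.-1 v.
Proof.
move=> j12; rewrite /tube_nilp (linfun_linear tube_step_linear) /co ffunE.
by rewrite /= inordK.
Qed.

(** The kernel of these equations is the submodule generated by the elements
Y^2 E1(s) + Y E2(s) + E3(s) and Y^2 E2(t) + Y E3(J t), where J is the shift.
In the degree 0 part of the obvious grading, which is three copies of S, the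
operator determines two opposite flags and the submodule a line and a plane
containing it, all up to tensoring with S; J is the parameter of this
configuration of affine type E6. *)
Definition tube_eqs (v : V) : {ffun 'I_6 -> S} :=
  [ffun i : 'I_6 => nth 0 [:: co 0 v; co 1 v; co 6 v; co 7 v - co 2 v;
      co 10 v - co 2 v; co 11 v - co 3 v - shift k m (co 8 v - co 3 v)] i].

Lemma tube_eqs_linear : linear tube_eqs.
Proof.
move=> c v w; apply/ffunP => -[i i6]; rewrite !ffunE /=.
have sub2 (a a' b b' : S) :
    c *: a + a' - (c *: b + b') = c *: (a - b) + (a' - b').
  by rewrite scalerBr opprD addrACA.
do 6!(case: i i6 => [_|i i6] /=;
  first by rewrite !co_lin ?sub2 // lfun_add lfun_scale sub2).
by [].
Qed.

Definition tube_sub : {vspace V} := lker (linfun tube_eqs).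

Lemma tube_subP v :
  reflect [/\ co 0 v = 0, co 1 v = 0, co 6 v = 0, co 7 v = co 2 v
             & co 10 v = co 2 v
               /\ co 11 v - co 3 v = shift k m (co 8 v - co 3 v)]
          (v \in tube_sub).
Proof.
rewrite memv_ker (linfun_linear tube_eqs_linear).
apply: (iffP eqP) => [/ffunP v0|[v0 v1 v6 v7 [v10 v11]]]; last first.
  apply/ffunP => -[i i6]; rewrite !ffunE /= v0 v1 v6 v7 v10 v11 !subrr.
  by do 6!(case: i i6 => [//|i i6]).
have e i (i6 : (i < 6)%N) := v0 (Ordinal i6); move: e; clear v0 => e.
split; [move: (e 0%N isT)|move: (e 1%N isT)|move: (e 2 isT)|move: (e 3 isT)
       |split; [move: (e 4 isT)|move: (e 5 isT)]];
  by rewrite !ffunE //= => /subr0_eq.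
Qed.

Lemma tube_sub_stable : {in tube_sub, forall v, tube_nilp v \in tube_sub}.
Proof.
move=> v /tube_subP[v0 v1 v6 v7 [v10 v11]].
by apply/tube_subP; rewrite !co_nilp //= v0 v1 v6 v7 v10 !subrr lfun0.
Qed.

Lemma tube_nilp6 v : iter 6 tube_nilp v = 0.
Proof.
apply: co_inj => j j12; rewrite co0.
do 12!(case: j j12 => [_|j j12]; first by do !rewrite /= co_nilp //).
by [].
Qed.

Definition tube_gen (j : nat) (s : S) : V :=
  [ffun i : 'I_12 => if val i == j then s else 0].

Lemma co_gen i j s : (i < 12)%N -> co i (tube_gen j s) = if i == j then s else 0.
Proof. by move=> i12; rewrite /co ffunE /= inordK. Qed.

Lemma tube_gen_linear j : linear (tube_gen j).
Proof.
move=> c u v; apply/ffunP => i; rewrite !ffunE.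
by case: ifP; rewrite ?scaler0 ?addr0.
Qed.

(** The action on the subquotient of V spanned by E3. *)
Definition tube_diag (phi : 'End(V)) : 'End(S) :=
  (linfun (co 10) \o phi \o linfun (tube_gen 10))%VF.

Lemma tube_diagE phi s : tube_diag phi s = co 10 (phi (tube_gen 10 s)).
Proof.
rewrite !comp_lfunE (linfun_linear (tube_gen_linear 10)) linfun_linear //.
exact: co_lin.
Qed.

(** Nilpotency degrees make phi triangular on Y^2 E1, Y E2, E3.  The first kind of
generators of the submodule forces its diagonal entries to agree, and the second
kind forces their common value to commute with the shift. *)
Lemma tube_diag_shift (phi : 'End(V)) :
  (forall v, phi (tube_nilp v) = tube_nilp (phi v)) ->
  {in tube_sub, forall v, phi v \in tube_sub} ->
  forall s, tube_diag phi (shift k m s) = shift k m (tube_diag phi s).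
Proof.
move=> phiY phiU s; rewrite !tube_diagE.
have phi_iter j v : phi (iter j tube_nilp v) = iter j tube_nilp (phi v).
  by elim: j => //= j <-.
have gen2_nil t : iter 4 tube_nilp (tube_gen 6 t) = 0.
  apply: co_inj => j j12; rewrite co0.
  do 12!(case: j j12 => [_|j j12]; first by do !rewrite /= ?co_gen // co_nilp).
  by [].
have gen3_nil t : iter 2 tube_nilp (tube_gen 10 t) = 0.
  apply: co_inj => j j12; rewrite co0.
  do 12!(case: j j12 => [_|j j12]; first by do !rewrite /= ?co_gen // co_nilp).
  by [].
have gen3_co t j : (j < 12)%N ->
    co j (iter 2 tube_nilp (phi (tube_gen 10 t))) = 0.
  by move=> j12; rewrite -phi_iter gen3_nil lfun0 co0.
have gen2_co t j : (j < 12)%N ->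
    co j (iter 4 tube_nilp (phi (tube_gen 6 t))) = 0.
  by move=> j12; rewrite -phi_iter gen2_nil lfun0 co0.
have z2 t : co 2 (phi (tube_gen 10 t)) = 0.
  by rewrite -(gen3_co t 4) //= !co_nilp.
have z7 t : co 7 (phi (tube_gen 10 t)) = 0.
  by rewrite -(gen3_co t 9) //= !co_nilp.
have y1 t : co 1 (phi (tube_gen 6 t)) = 0.
  by rewrite -(gen2_co t 5) //= !co_nilp.
have diag t : co 6 (phi (tube_gen 6 t)) = co 10 (phi (tube_gen 10 t)).
  pose u := iter 2 tube_nilp (tube_gen 0 t) + iter 1 tube_nilp (tube_gen 6 t)
            + tube_gen 10 t.
  have uU : u \in tube_sub.
    apply/tube_subP; rewrite /u !coD /= !co_nilp //= ?co_nilp //= !co_gen //=.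
    by rewrite !addr0 !add0r oppr0 lfun0.
  have /tube_subP[_ _ _] := phiU u uU; rewrite /u !lfun_add !phi_iter !coD /=.
  by rewrite !co_nilp //= ?co_nilp //= z7 !addr0 !add0r => -> [-> _].
pose w := iter 2 tube_nilp (tube_gen 6 s)
          + iter 1 tube_nilp (tube_gen 10 (shift k m s)).
have wU : w \in tube_sub.
  apply/tube_subP; rewrite /w !coD /= !co_nilp //= ?co_nilp //= !co_gen //=.
  by rewrite !addr0 !add0r !subr0.
have /tube_subP[_ _ _ _ [_]] := phiU w wU.
rewrite /w !lfun_add !phi_iter !coD /=.
rewrite !co_nilp //= ?co_nilp //= y1 z2 z7 !addr0 !add0r !subr0 diag.
by rewrite oppr0 lfun0 addr0.
Qed.

Lemma tube_diag_sum (phis : seq 'End(V)) s :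
  (forall v, v = \sum_(phi <- phis) phi v) ->
  s = \sum_(phi <- phis) tube_diag phi s.
Proof.
move=> sum1; under eq_bigr do rewrite tube_diagE.
have -> : \sum_(phi <- phis) co 10 (phi (tube_gen 10 s))
        = co 10 (\sum_(phi <- phis) phi (tube_gen 10 s)).
  by elim/big_rec2: _ => [|phi v t _ ->]; rewrite ?co0 ?coD.
by rewrite -sum1 co_gen.
Qed.

Lemma tube_diag_rank (phi : 'End(V)) :
  (\dim (limg (tube_diag phi)) <= \dim (limg phi))%N.
Proof.
rewrite /tube_diag !limg_comp.
apply: (@leq_trans (\dim (phi @: limg (linfun (tube_gen 10))))).
  by rewrite -[leqRHS](limg_ker_dim (linfun (co 10))) leq_addl.
by rewrite dimvS // limgS // subvf.
Qed.

Lemma tube_no_small_decomposition (phis : seq 'End(V)) :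
  (forall phi, phi \in phis ->
     [/\ forall v, phi (tube_nilp v) = tube_nilp (phi v),
         {in tube_sub, forall v, phi v \in tube_sub}
       & (\dim (limg phi) <= m)%N]) ->
  ~ (forall v, v = \sum_(phi <- phis) phi v).
Proof.
move=> small sum1; have := tube_diag_sum (delta_mx 0 0) sum1; rewrite big1_seq.
  move/rowP/(_ 0)/eqP; rewrite !mxE !eqxx; apply/negP; exact: oner_neq0.
move=> phi /andP[_ /small[phiY phiU phi_rank]].
apply: shift_commutant; first exact: tube_diag_shift.
rewrite -dimv_eq0 -lt0n -(ltn_add2r (\dim (limg (tube_diag phi)))) add0n.
rewrite -[in ltnRHS](capfv (lker _)) limg_ker_dim dimvf /dim /= mul1n ltnS.
exact: leq_trans (tube_diag_rank phi) phi_rank.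
Qed.
End Tube.

(** * Group algebras of cyclic groups *)

Section CyclicGroupAlgebra.
Variables (k : fieldType) (gT : finGroupType) (z : gT).
Hypothesis z_gen : [set: gT] = <[z]>%g.
Local Notation kG := (group_algebra k gT).

Lemma galg_basis (f : kG) : f = \sum_(y : gT) f y *: (galg_elt k y : kG).
Proof.
apply/ffunP => y; rewrite sum_ffunE (bigD1 y) //= galg_scaleE ffunE eqxx mulr1.
by rewrite big1 ?addr0 // => w /negPf wy; rewrite galg_scaleE ffunE eq_sym wy mulr0.
Qed.

Lemma gen_pow (y : gT) : exists i, y == (z ^+ i)%g.
Proof.
have /cycleP[i ->] : y \in <[z]>%g by rewrite -z_gen inE.
by exists i.
Qed.

Lemma galg_gen_ind (S : kG -> Prop) :
  S 1 -> (forall a a', S a -> S a' -> S (a + a')) ->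
  (forall (c : k) a, S a -> S (c *: a)) ->
  (forall a, S a -> S (a * (galg_elt k z - 1))) -> forall a, S a.
Proof.
move=> S1 SD SZ SM a; rewrite [a]galg_basis.
have S0 : S 0 by rewrite -(scale0r (1 : kG)); apply: SZ.
elim/big_ind: _ => // y _; apply: SZ; have [i /eqP->] := gen_pow y.
elim: i => [|i IHi]; first by rewrite expg0.
rewrite expgSr -galg_eltM -[galg_elt k z](subrK 1) mulrDr mulr1.
by apply: SD => //; apply: SM.
Qed.

Lemma galg_gen_nilp p : p \in [pchar k] -> (#[z] = p)%g ->
  ((galg_elt k z : kG) - 1) ^+ p = 0.
Proof.
move=> char_k ordz; have char_kG : p \in [pchar kG] by rewrite pchar_lalg.
have -> : (galg_elt k z - 1 : kG) ^+ p
  = pFrobenius_aut char_kG (galg_elt k z - 1) by [].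
rewrite pFrobenius_autB_comm ?pFrobenius_aut1; last exact: commr1.
rewrite pFrobenius_autE.
have zX i : (galg_elt k z : kG) ^+ i = galg_elt k (z ^+ i)%g.
  by elim: i => [|i IHi]; rewrite ?expr0 ?expg0 // exprS IHi galg_eltM expgS.
by rewrite zX -ordz expg_order subrr.
Qed.

Section Representation.
Variables (V : vectType k) (T : 'End(V)).
Hypothesis T_order : forall v, iter #[z]%g T v = v.

Definition gen_log (y : gT) : nat := xchoose (gen_pow y).

Lemma gen_logK y : (z ^+ gen_log y)%g = y.
Proof. by rewrite -(eqP (xchooseP (gen_pow y))). Qed.

Lemma iter_gen_pow i j v : (z ^+ i = z ^+ j)%g -> iter i T v = iter j T v.
Proof.
have modE n : iter n T v = iter (n %% #[z]%g) T v.
  rewrite [in LHS](divn_eq n #[z]%g) addnC iterD; congr (iter _ T _).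
  by elim: (n %/ _)%N => //= q IHq; rewrite mulSn iterD IHq T_order.
by move/eqP; rewrite eq_expg_mod_order => /eqP zij; rewrite modE zij -modE.
Qed.

Lemma iter_logM y w v :
  iter (gen_log (y * w)%g) T v = iter (gen_log y) T (iter (gen_log w) T v).
Proof. by rewrite -iterD; apply: iter_gen_pow; rewrite expgD !gen_logK. Qed.

(** The action of the group algebra for which the generator z acts as T. *)
Definition galg_rep (f : kG) : 'End(V) :=
  linfun (fun v => \sum_y f y *: iter (gen_log y) T v).

Lemma galg_repE f v : galg_rep f v = \sum_y f y *: iter (gen_log y) T v.
Proof.
rewrite linfun_linear // => c u u'; rewrite scaler_sumr -big_split.
apply: eq_bigr => y _.
by rewrite iter_endoD iter_endoZ scalerDr !scalerA mulrC.
Qed.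

Lemma galg_rep_gen v : galg_rep (galg_elt k z) v = T v.
Proof.
rewrite galg_repE (bigD1 z) //= big1 ?addr0 => [|y /negPf yz].
  rewrite ffunE eqxx scale1r -[RHS]/(iter 1 T v); apply: iter_gen_pow.
  by rewrite gen_logK expg1.
by rewrite ffunE yz scale0r.
Qed.

Lemma galg_rep_stable (U : {vspace V}) f :
  {in U, forall u, T u \in U} -> {in U, forall u, galg_rep f u \in U}.
Proof.
move=> TU u uU; rewrite galg_repE; apply: memv_suml => y _.
by rewrite memvZ // iter_endo_mem.
Qed.

Lemma galg_representation : representation galg_rep.
Proof.
split=> [f h|f h|c]; apply/lfunP => v.
- rewrite add_lfunE !galg_repE -big_split; apply: eq_bigr => y _.
  by rewrite ffunE scalerDl.
- rewrite comp_lfunE !galg_repE.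
  under eq_bigr do rewrite galg_mulE scaler_suml.
  rewrite exchange_big; apply: eq_bigr => w _ /=.
  have -> : iter (gen_log w) T (\sum_y h y *: iter (gen_log y) T v)
          = \sum_y h y *: iter (gen_log (w * y)%g) T v.
    elim/big_rec2: _ => [|y u u' _ <-]; first by rewrite iter_endo0.
    by rewrite iter_endoD iter_endoZ iter_logM.
  rewrite scaler_sumr (reindex_inj (mulgI w)); apply: eq_bigr => y _ /=.
  by rewrite mulKg scalerA.
rewrite scale_lfunE id_lfunE galg_repE (bigD1 1%g) //= big1 => [|y /negPf y1].
  rewrite addr0 galg_scaleE ffunE eqxx mulr1; congr (_ *: _).
  by rewrite -[RHS]/(iter 0 T v); apply: iter_gen_pow; rewrite gen_logK expg0.
by rewrite galg_scaleE ffunE y1 mulr0 scale0r.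
Qed.
End Representation.
End CyclicGroupAlgebra.

(** The Frobenius identity (1 + Y)^3 = 1 + Y^3. *)
Lemma iter3_unipotent (k : fieldType) (V : vectType k) (T Y : V -> V) v :
  3 \in [pchar k] -> (forall u w, Y (u + w) = Y u + Y w) ->
  (forall u, T u = u + Y u) -> iter 3 T v = v + iter 3 Y v.
Proof.
move=> char_k YD TE; have V3 (u : V) : u + u + u = 0.
  rewrite -[X in X + u]mulr2n -mulrSr -scaler_nat.
  by have /andP[_ /eqP ->] := char_k; rewrite scale0r.
rewrite /= !TE !YD.
have -> : v + Y v + (Y v + Y (Y v)) + (Y v + Y (Y v) + (Y (Y v) + Y (Y (Y v))))
  = v + (Y v + Y v + Y v) + (Y (Y v) + Y (Y v) + Y (Y v)) + Y (Y (Y v)).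
  by rewrite !addrA; congr (_ + _ + _ + _); apply: addrAC.
by rewrite !V3 !addr0.
Qed.

Lemma unipotent_order (k : fieldType) (V : vectType k) (Y : 'End(V)) n v :
  3 \in [pchar k] -> (forall u, iter 9 Y u = 0) -> (1 < n)%N ->
  iter (3 ^ n) (\1 + Y)%VF v = v.
Proof.
move=> char_k Y9 n1.
have T1 u : (\1 + Y)%VF u = u + Y u by rewrite add_lfunE id_lfunE.
have T3 u : iter 3 (\1 + Y)%VF u = u + iter 3 Y u.
  exact: (iter3_unipotent _ char_k (lfun_add Y) T1).
have T9 u : iter 9 (\1 + Y)%VF u = u.
  have := iter3_unipotent u char_k (iter_endoD Y 3) T3.
  have iter9 (F : V -> V) : iter 3 (iter 3 F) u = iter 9 F u by [].
  by rewrite !iter9 Y9 addr0.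
rewrite -(subnK n1) expnD.
by elim: (3 ^ _)%N => // q IHq; rewrite mulSn iterD IHq T9.
Qed.

(** * Separable equivalence *)

Lemma left_generators (k : fieldType) (A B : algType k) (N : bimodType A B) :
  fin_generated (left_module N) ->
  exists (g : nat) (nu : 'I_g -> N) (coef : N -> 'I_g -> A),
    forall n, n = \sum_i actl (coef n i) (nu i).
Proof.
by move=> [g [nu /choice[coef coefE]]]; exists g, nu, coef => n; apply: coefE.
Qed.

Lemma right_generators (k : fieldType) (A B : algType k) (M : bimodType A B) :
  fin_generated (right_module M) ->
  exists (h : nat) (mu : 'I_h -> M) (coef : M -> 'I_h -> B),
    forall m, m = \sum_i actr (mu i) (coef m i).
Proof.
by move=> [h [mu /choice[coef coefE]]]; exists h, mu, coef => m; apply: coefE.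
Qed.

Lemma cyclic_full_generator (gT : finGroupType) :
  cyclic [set: gT] ->
  exists2 z : gT, [set: gT] = <[z]>%g & #[z]%g = #|[set: gT]|.
Proof. by case/cyclicP=> z zE; exists z; rewrite ?zE. Qed.

(** The pair over B is chosen after e, with m equal to the rank bound 4r of the
transferred endomorphisms. *)
Lemma galg_not_bimodule_summand (k : fieldType) (gT hT : finGroupType) (n : nat)
    (z : gT) (w : hT) (N : bimodType (group_algebra k hT) (group_algebra k gT))
    (M : bimodType (group_algebra k gT) (group_algebra k hT))
    (Y : bimodType (group_algebra k hT) (group_algebra k hT)) :
  3 \in [pchar k] -> (1 < n)%N ->
  [set: gT] = <[z]>%g -> #[z]%g = 3 ->
  [set: hT] = <[w]>%g -> #[w]%g = (3 ^ n)%N ->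
  fin_generated (left_module N) -> fin_generated (right_module M) ->
  ~ bimod_iso (tensor N M) (regular_bimodule (group_algebra k hT) * Y)%type.
Proof.
move=> char_k n1 z_gen z_ord w_gen w_ord /left_generators[g [nu [nuc nuE]]].
move=> /right_generators[h [mu [muc muE]]].
move=> /regular_summand[p [e [pD pl pr pe e_cent]]].
have [s sE] := tensor_sum e; rewrite {}sE in pe e_cent.
pose m := (4 * size s)%N; pose V := {ffun 'I_12 -> 'rV[k]_m.+1}.
pose T : 'End(V) := (\1 + tube_nilp k m)%VF.
have TE v : T v = v + tube_nilp k m v by rewrite add_lfunE id_lfunE.
have T_ord v : iter #[w]%g T v = v.
  rewrite w_ord; apply: unipotent_order => // u.
  by rewrite -[9%N]/(3 + 6)%N iterD tube_nilp6 iter_endo0.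
have rep := galg_representation w_gen T_ord.
have tube_stable b :
    {in tube_sub k m, forall u, galg_rep w_gen T b u \in tube_sub k m}.
  by apply: galg_rep_stable => u uU; rewrite TE memvD ?tube_sub_stable.
pose beta (x : N) (y : M) := p (tens x y).
have [|||||||phis phis_endo phis_sum] :=
  @transfer_decomposition k _ _ N M beta _ _ _ _ _ g h nu mu nuc muc nuE muE
    (galg_elt k z - 1) _ (galg_gen_ind z_gen) V _ (tube_sub k m) rep
    tube_stable s e_cent.
- by move=> x x' y; rewrite /beta tensDl pD.
- by move=> x y y'; rewrite /beta tensDr pD.
- by move=> b x y; rewrite -pl; congr p; apply/esym/tensor_actlE.
- by move=> x y b; rewrite -pr; congr p; apply/esym/tensor_actrE.
- by move=> x a y; rewrite /beta tens_bal.
- exact: galg_gen_nilp.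
- have p0 : p 0 = 0 by apply: (addrI (p 0)); rewrite -pD !addr0.
  rewrite -[RHS]pe; elim/big_rec2: _ => [|y t b _ ->]; by rewrite ?p0 ?pD.
apply: (@tube_no_small_decomposition k m phis) => // phi.
move=> /phis_endo[phi_comm phiU phi_rank].
split=> // v; apply: (addrI (phi v)).
by rewrite -lfun_add -!TE -!(galg_rep_gen w_gen T_ord) phi_comm.
Qed.

Local Close Scope ring_scope.

Theorem mainTheorem10 (k : fieldType) (char_k : 3 \in [pchar k]%R)
    (n : nat) (n_gt1 : 1 < n) (C3 C3n : finGroupType)
    (C3_cyclic : cyclic [set: C3]) (C3_order : #|[set: C3]| = 3)
    (C3n_cyclic : cyclic [set: C3n]) (C3n_order : #|[set: C3n]| = 3 ^ n) :
  ~ separably_equivalent k (group_algebra k C3) (group_algebra k C3n).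
Proof.
have [z z_gen z_ord] := cyclic_full_generator C3_cyclic.
have [w w_gen w_ord] := cyclic_full_generator C3n_cyclic.
case=> M [N [X [Y [[_ _ M_fin _] [N_fin _ _ _] _ NM_iso]]]].
apply: (galg_not_bimodule_summand char_k n_gt1 z_gen _ w_gen _ N_fin M_fin NM_iso).
  by rewrite z_ord.
by rewrite w_ord.
Qed.
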